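(* In the category whose objects are (nonzero) complex operator systems and whose morphisms are unital completely positive $\mathbb{C}$-linear maps, there are no injective objects in the purely categorical sense.
   Context: A complex operator system is a self-adjoint complex linear subspace of $B(H)$, $H$ a complex Hilbert space, containing the identity operator $I_H$, with the inherited matrix norms and orders; operator systems are nonzero. In a category, a morphism $f:X\to Y$ is a monomorphism if for every object $W$ and all morphisms $g_1,g_2:W\to X$, $f\circ g_1=f\circ g_2$ implies $g_1=g_2$. An object $Z$ is injective in the purely categorical sense if for all objects $X,Y$, every morphism $f:X\to Z$ and every monomorphism $\iota:X\to Y$ (no isometry or order embedding condition is imposed), there is a morphism $\tilde f:Y\to Z$ with $\tilde f\circ\iota=f$. *)

(* Defs.v *)
From HB Require Import structures.
From mathcomp Require Import all_boot all_order all_algebra.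
From mathcomp Require Import sesquilinear complex.
From mathcomp Require Import boolp classical_sets functions reals.
From mathcomp Require Import topology normedtype.

Set Implicit Arguments.
Unset Strict Implicit.
Unset Printing Implicit Defensive.

Import Order.TTheory GRing.Theory Num.Theory.
Import numFieldNormedType.Exports.

Local Open Scope ring_scope.

Record category := Category {
  cat_obj :> Type;
  cat_hom : cat_obj -> cat_obj -> Type;
  cat_id : forall X, cat_hom X X;
  cat_comp : forall X Y Z, cat_hom Y Z -> cat_hom X Y -> cat_hom X Z;
  cat_comp_idl : forall X Y (f : cat_hom X Y), cat_comp (cat_id Y) f = f;
  cat_comp_idr : forall X Y (f : cat_hom X Y), cat_comp f (cat_id X) = f;
  cat_comp_assoc : forall W X Y Z (f : cat_hom Y Z) (g : cat_hom X Y) (h : cat_hom W X),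
    cat_comp f (cat_comp g h) = cat_comp (cat_comp f g) h
}.

Definition monomorphism (C : category) (X Y : C) (f : cat_hom X Y) :=
  forall (W : C) (g1 g2 : cat_hom W X), cat_comp f g1 = cat_comp f g2 -> g1 = g2.

Definition injective_object (C : category) (Z : C) :=
  forall (X Y : C) (f : cat_hom X Z) (i : cat_hom X Y),
    monomorphism i -> exists g : cat_hom Y Z, cat_comp g i = f.

(* The inner product is linear in its first argument and conjugate-linear in
   its second; it determines the norm for which the space is complete. *)
Record hilbert (R : realType) := Hilbert {
  hspace :> completeNormedModType R[i];
  inner : {dot hspace for Num.conj};
  inner_norm : forall x : hspace, inner x x = `|x| ^+ 2
}.

Section Operators.
Variables (R : realType) (H : hilbert R).

Definition bounded_operator (a : H -> H) : Prop :=
  linear a /\ exists M : R[i], forall x : H, `|a x| <= M * `|x|.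

(* [b] is the adjoint of [a]; it is unique, and exists when [a] is bounded. *)
Definition adjoint (a b : H -> H) : Prop :=
  forall x y : H, inner H (a x) y = inner H x (b y).

End Operators.

(* [os_space] is a complex linear subspace of the space of all functions from
   [os_hilbert] to itself, with pointwise operations. *)
Record opsystem (R : realType) := OpSystem {
  os_hilbert : hilbert R;
  os_space : submodClosed (os_hilbert -> os_hilbert);
  os_bounded : forall a, a \in os_space -> bounded_operator a;
  os_selfadjoint : forall a, a \in os_space ->
    exists2 b, b \in os_space & adjoint a b;
  os_id : (id : os_hilbert -> os_hilbert) \in os_space;
  os_neq0 : exists2 a, a \in os_space & a <> 0
}.

Definition os_elt (R : realType) (S : opsystem R) : Type :=
  {a : os_hilbert S -> os_hilbert S | a \in os_space S}.

Section OsElt.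
Variables (R : realType) (S : opsystem R).

HB.instance Definition _ := [isSub of os_elt S for @sval _ _].
HB.instance Definition _ := [Choice of os_elt S by <:].
HB.instance Definition _ := [SubChoice_isSubLmodule of os_elt S by <:].

Definition os_one : os_elt S := exist _ id (os_id S).

(* The matrix [A] acts on the [n]-fold Hilbert sum of [os_hilbert S] by
   (A x)_i = \sum_j A_ij x_j, and is positive iff <A x, x> >= 0 for all x. *)
Definition mx_positive n (A : 'M[os_elt S]_n) : Prop :=
  forall x : 'I_n -> os_hilbert S,
    0 <= \sum_i \sum_j inner (os_hilbert S) (val (A i j) (x j)) (x i).

End OsElt.

Definition completely_positive (R : realType) (S T : opsystem R)
    (f : os_elt S -> os_elt T) : Prop :=
  forall n (A : 'M[os_elt S]_n), mx_positive A -> mx_positive (map_mx f A).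

Record ucp (R : realType) (S T : opsystem R) := Ucp {
  ucp_fun :> os_elt S -> os_elt T;
  ucp_linear : linear ucp_fun;
  ucp_unital : ucp_fun (os_one S) = os_one T;
  ucp_cp : completely_positive ucp_fun
}.

Section UcpCategory.
Variable R : realType.
Implicit Types S T U : opsystem R.

Lemma ucp_ext S T (f g : ucp S T) : f =1 g -> f = g.
Proof.
case: f g => [f f1 f2 f3] [g g1 g2 g3] /= /funext fg.
by subst g; congr Ucp; exact: Prop_irrelevance.
Qed.

Definition ucp_id S : ucp S S.
Proof. by exists id => // n A; rewrite map_mx_id. Defined.

Definition ucp_comp S T U (g : ucp T U) (f : ucp S T) : ucp S U.
Proof.
exists (g \o f).
- by move=> c x y /=; rewrite !ucp_linear.
- by rewrite /= !ucp_unital.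
- by move=> n A Apos; rewrite map_mx_comp; do 2!apply: ucp_cp.
Defined.

Definition opsystem_category : category.
Proof.
by refine (@Category (opsystem R) (@ucp R) ucp_id ucp_comp _ _ _) => *;
  exact: ucp_ext.
Defined.

End UcpCategory.

(* Main.v *)
(* Let H be the Hilbert space of an operator system Z, and let C^2 act on the
   Hilbert sum of H with itself by diagonal operators. The ucp map
   i(s, t) = ((2s + t)/3, (2t + s)/3) of C^2 into itself is injective, hence a
   monomorphism, but it is not an order embedding: it sends the non-positive
   (-1, 2) to the positive (0, 1). Hence the ucp map (s, t) |-> s 1 into Z does
   not factor through i: the second map would send (0, 1) to -1. *)
Require Import Defs.
From HB Require Import structures.
From mathcomp Require Import all_boot all_order all_algebra.
From mathcomp Require Import sesquilinear complex ring.
From mathcomp Require Import boolp classical_sets functions reals.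
From mathcomp Require Import topology normedtype.

Set Implicit Arguments.
Unset Strict Implicit.
Unset Printing Implicit Defensive.

Import Order.TTheory GRing.Theory Num.Theory.
Import numFieldNormedType.Exports.

Local Open Scope ring_scope.

(** Squaring twice removes the roots and leaves Lagrange's identity: the defect in Cauchy-Schwarz is
    $(ad - bc)^2 \ge 0$. This is the source of the triangle inequality on a Hilbert sum. *)
Lemma minkowski2 (C : numClosedFieldType) (a b c d : C) :
  0 <= a -> 0 <= b -> 0 <= c -> 0 <= d ->
  sqrtC ((a + c) ^+ 2 + (b + d) ^+ 2) <=
    sqrtC (a ^+ 2 + b ^+ 2) + sqrtC (c ^+ 2 + d ^+ 2).
Proof.
move=> a0 b0 c0 d0.
have ge0 (u v : C) : 0 <= u -> 0 <= v -> 0 <= u ^+ 2 + v ^+ 2.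
  by move=> u0 v0; rewrite addr_ge0 ?exprn_ge0.
have s1 := ge0 _ _ a0 b0; have s2 := ge0 _ _ c0 d0.
rewrite -ler_sqr ?nnegrE ?addr_ge0 ?sqrtC_ge0 ?ge0 ?addr_ge0 //.
rewrite [leRHS]sqrrD !sqrtCK.
have -> : (a + c) ^+ 2 + (b + d) ^+ 2 =
    a ^+ 2 + b ^+ 2 + (a * c + b * d) *+ 2 + (c ^+ 2 + d ^+ 2) by ring.
rewrite lerD2r lerD2l lerMn2r /= -ler_sqr ?nnegrE ?mulr_ge0 ?sqrtC_ge0 //;
  last by rewrite addr_ge0 ?mulr_ge0.
rewrite exprMn !sqrtCK -subr_ge0.
have -> : (a ^+ 2 + b ^+ 2) * (c ^+ 2 + d ^+ 2) - (a * c + b * d) ^+ 2 =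
   (a * d - b * c) ^+ 2 by ring.
by rewrite real_exprn_even_ge0 // rpredB // ger0_real ?mulr_ge0.
Qed.

(** * The Hilbert sum of two Hilbert spaces *)

Section HilbertSum.
Variables (R : realType) (H K : hilbert R).

(* A new name, since [H * K] itself carries the sup norm. *)
Definition hsum : Type := (H * K)%type.

HB.instance Definition _ := GRing.Lmodule.copy hsum (H * K)%type.

Definition hsum_norm (p : hsum) : R[i] := sqrtC (`|p.1| ^+ 2 + `|p.2| ^+ 2).

Lemma hsum_sqr_ge0 (p : hsum) : 0 <= `|p.1| ^+ 2 + `|p.2| ^+ 2.
Proof. by rewrite addr_ge0 ?exprn_ge0. Qed.

Lemma hsum_normD p q : hsum_norm (p + q) <= hsum_norm p + hsum_norm q.
Proof.
apply: le_trans (minkowski2 _ _ _ _) => //.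
rewrite ler_sqrtC ?nnegrE ?hsum_sqr_ge0 ?addr_ge0 ?exprn_ge0 ?addr_ge0 //.
by rewrite lerD // ler_sqr ?nnegrE ?addr_ge0 // ler_normD.
Qed.

Lemma hsum_normZ c p : hsum_norm (c *: p) = `|c| * hsum_norm p.
Proof.
rewrite /hsum_norm /= !normrZ !exprMn -mulrDr.
rewrite sqrtCM ?nnegrE ?exprn_ge0 ?hsum_sqr_ge0 //.
by rewrite sqrCK.
Qed.

Lemma hsum_norm_eq0 p : hsum_norm p = 0 -> p = 0.
Proof.
move/eqP; rewrite sqrtC_eq0 paddr_eq0 ?exprn_ge0 // !expf_eq0 /= !normr_eq0.
by case: p => x y /= /andP[/eqP-> /eqP->].
Qed.

HB.instance Definition _ :=
  Lmodule_isNormed.Build R[i] hsum hsum_normD hsum_normZ hsum_norm_eq0.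

Lemma hsum_normE (p : hsum) : `|p| = hsum_norm p.
Proof. by []. Qed.

Lemma hsum_norm_sqr (p : hsum) : `|p| ^+ 2 = `|p.1| ^+ 2 + `|p.2| ^+ 2.
Proof. by rewrite hsum_normE sqrtCK. Qed.

Lemma hsum_norm_fst (p : hsum) : `|p.1| <= `|p|.
Proof. by rewrite -ler_sqr ?nnegrE // hsum_norm_sqr lerDl exprn_ge0. Qed.

Lemma hsum_norm_snd (p : hsum) : `|p.2| <= `|p|.
Proof. by rewrite -ler_sqr ?nnegrE // hsum_norm_sqr lerDr exprn_ge0. Qed.

Lemma hsum_norm_le (p : hsum) : `|p| <= `|p.1| + `|p.2|.
Proof.
rewrite -ler_sqr ?nnegrE ?addr_ge0 // hsum_norm_sqr sqrrD lerD2r lerDl.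
by rewrite mulrn_wge0 ?mulr_ge0.
Qed.

Local Open Scope classical_set_scope.

(** The images under [f] of two [e]-close sets are again [e]-close. It is meant for the two
    coordinate projections. *)
Lemma contraction_cauchy (V : normedModType R[i]) (f : hsum -> V)
    (F : set_system hsum) : Filter F ->
  (forall p q, `|f p - f q| <= `|p - q|) -> cauchy F -> cauchy (f @ F).
Proof.
move=> FF fle /cauchy_ballP Fc; apply/cauchy_ballP => e e0.
have [[/= A B] [FA FB] AB] := Fc e e0.
exists (f @` A, f @` B) => /=.
  by split; [move: FA | move: FB]; apply: filterS => p; exists p.
move=> [_ _] [/= [p Ap <-] [q Bq <-]].
have := AB (p, q) (conj Ap Bq).
by rewrite -!ball_normE /=; apply: le_lt_trans.
Qed.

(** Both projections are contractions, so the coordinates converge by completeness of [H] and [K];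
    since the norm of a pair is at most the sum of the norms of its coordinates, the pair of limits
    is a limit. *)
Lemma hsum_complete (F : set_system hsum) : ProperFilter F -> cauchy F -> cvg F.
Proof.
move=> FF Fc.
have /cauchy_cvgP/cvg_ex[x /= Fx] : cauchy ((fst : hsum -> H) @ F).
  by apply: contraction_cauchy Fc => p q; exact: hsum_norm_fst (p - q).
have /cauchy_cvgP/cvg_ex[y /= Fy] : cauchy ((snd : hsum -> K) @ F).
  by apply: contraction_cauchy Fc => p q; exact: hsum_norm_snd (p - q).
apply/cvg_ex; exists ((x, y) : hsum); apply/cvgrPdist_lt => e e0.
have e20 : 0 < e / 2 by rewrite divr_gt0.
move/cvgrPdist_lt/(_ _ e20) : Fx; move/cvgrPdist_lt/(_ _ e20) : Fy.
apply: filterS2 => p yp xp; apply: le_lt_trans (hsum_norm_le _) _.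
by rewrite [e]splitr ltrD.
Qed.

HB.instance Definition _ := Uniform_isComplete.Build hsum hsum_complete.

Definition hsum_inner (p q : hsum) : R[i] :=
  inner H p.1 q.1 + inner K p.2 q.2.

Lemma hsum_inner_bilinear : bilinear_for
  (GRing.Scale.Law.clone _ _ *%R _)
  (GRing.Scale.Law.clone _ _ (Num.conj \; *%R) _) hsum_inner.
Proof.
split=> u c p q; rewrite /hsum_inner /=.
  by rewrite !linearPl /= mulrDr addrACA.
by rewrite !linearPr /= mulrDr addrACA.
Qed.

HB.instance Definition _ := bilinear_isBilinear.Build
  R[i] hsum hsum R[i] _ _ hsum_inner hsum_inner_bilinear.

(** The factor [(-1) ^+ false] is 1: it is the sign by which the interface tells Hermitian forms
    from skew-Hermitian ones. *)
Lemma hsum_inner_herm p q : hsum_inner p q = (-1) ^+ false * (hsum_inner q p)^*.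
Proof. by rewrite /hsum_inner [in LHS]hermC [X in _ + X]hermC rmorphD mulrDr. Qed.

HB.instance Definition _ := isHermitianSesquilinear.Build
  R[i] hsum false Num.conj hsum_inner hsum_inner_herm.

Lemma hsum_inner_norm p : hsum_inner p p = `|p| ^+ 2.
Proof. by rewrite /hsum_inner !inner_norm hsum_norm_sqr. Qed.

Lemma hsum_inner_gt0 p : p != 0 -> 0 < hsum_inner p p.
Proof. by move=> p0; rewrite hsum_inner_norm exprn_gt0 ?normr_gt0. Qed.

HB.instance Definition _ :=
  isDotProduct.Build R[i] hsum hsum_inner hsum_inner_gt0.

Definition hilbert_sum : hilbert R :=
  @Hilbert R hsum hsum_inner hsum_inner_norm.

End HilbertSum.

(** * The system of diagonal operators and its injective, non-order-embedding endomorphism *)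

Section Diagonal.
Variables (R : realType) (H : hilbert R).
Hypothesis H_neq0 : exists x : H, x != 0.
Implicit Types (s t : R[i]).

Local Notation H2 := (hilbert_sum H H).

Definition diag_op s t : H2 -> H2 := fun p => (s *: p.1, t *: p.2).

Definition diag_ops : {pred H2 -> H2} :=
  fun a => `[< exists s t, a = diag_op s t >].

Lemma diag_opP (a : H2 -> H2) :
  reflect (exists s t, a = diag_op s t) (a \in diag_ops).
Proof. exact: asboolP. Qed.

Lemma diag_op_in s t : diag_op s t \in diag_ops.
Proof. by apply/diag_opP; exists s, t. Qed.

Lemma diag_ops_submod_closed : submod_closed diag_ops.
Proof.
split.
  apply/diag_opP; exists 0, 0.
  by apply/funext => p; congr pair; rewrite scale0r.
move=> c _ _ /diag_opP[s [t ->]] /diag_opP[s' [t' ->]].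
apply/diag_opP; exists (c * s + s'), (c * t + t').
by apply/funext => p; congr pair; rewrite /= scalerDl scalerA.
Qed.

HB.instance Definition _ := GRing.isSubmodClosed.Build R[i] (H2 -> H2) diag_ops
  (GRing.submod_closed_semi diag_ops_submod_closed).

Lemma diag_bounded a : a \in diag_ops -> bounded_operator a.
Proof.
move=> /diag_opP[s [t ->]]; split.
  by move=> c p q; congr pair; rewrite /= scalerDr !scalerA mulrC.
exists (`|s| + `|t|) => p.
apply: le_trans (hsum_norm_le _) _; rewrite /= !normrZ mulrDl.
by rewrite lerD ?ler_wpM2l ?hsum_norm_fst ?hsum_norm_snd.
Qed.

Lemma diag_selfadjoint a : a \in diag_ops ->
  exists2 b, b \in diag_ops & adjoint a b.
Proof.
move=> /diag_opP[s [t ->]]; exists (diag_op s^* t^*); first exact: diag_op_in.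
move=> p q; rewrite /= /hsum_inner /= !linearZl_LR /=.
by congr (_ + _); rewrite linearZr_LR /= conjCK.
Qed.

Lemma diag_id : (id : H2 -> H2) \in diag_ops.
Proof.
apply/diag_opP; exists 1, 1.
by apply/funext => -[x y]; congr pair; rewrite scale1r.
Qed.

Lemma diag_neq0 : exists2 a, a \in diag_ops & a <> 0.
Proof.
case: H_neq0 => x x0; exists id; first exact: diag_id.
by move=> /(congr1 (fun a : H2 -> H2 => (a (x, 0)).1)) /eqP; rewrite (negbTE x0).
Qed.

Definition diag_system : opsystem R :=
  OpSystem diag_bounded diag_selfadjoint diag_id diag_neq0.

Definition diag s t : os_elt diag_system :=
  exist _ (diag_op s t) (diag_op_in s t).

Lemma diagP (A : os_elt diag_system) : exists s t, A = diag s t.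
Proof.
by have /diag_opP[s [t As]] := valP A; exists s, t; apply: val_inj.
Qed.

Definition swap (p : H2) : H2 := (p.2, p.1).

(** The convex combination of [A], with weight 2/3, and its conjugate by the flip [swap], with
    weight 1/3. Conjugation by the flip exchanges the two diagonal entries; in this form complete
    positivity can be read off. *)
Definition average_fun (A : H2 -> H2) : H2 -> H2 :=
  fun p => 3^-1 *: (2 *: A p + swap (A (swap p))).

Lemma average_diag_op s t :
  average_fun (diag_op s t) = diag_op ((2 * s + t) / 3) ((2 * t + s) / 3).
Proof.
by apply/funext => p; congr pair; rewrite /= !scalerA -scalerDl scalerA mulrC.
Qed.

Lemma average_subproof (A : os_elt diag_system) :
  average_fun (val A) \in diag_ops.
Proof.
by have [s [t ->]] := diagP A; rewrite /= average_diag_op diag_op_in.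
Qed.

Definition average (A : os_elt diag_system) : os_elt diag_system :=
  exist _ (average_fun (val A)) (average_subproof A).

Lemma average_diag s t :
  average (diag s t) = diag ((2 * s + t) / 3) ((2 * t + s) / 3).
Proof. by apply: val_inj; rewrite /= average_diag_op. Qed.

Lemma diag_inj s t s' t' : diag s t = diag s' t' -> s = s' /\ t = t'.
Proof.
case: H_neq0 => x x0 /(congr1 (fun A => val A (x, x))) /= [].
(* A nonzero vector [x] placed in both summands recovers both scalars. *)
have scaler_injr u v : u *: x = v *: x -> u = v.
  move/eqP; rewrite -subr_eq0 -scalerBl scaler_eq0 (negbTE x0) orbF subr_eq0.
  by move/eqP.
by move=> /scaler_injr-> /scaler_injr->.
Qed.

Lemma average_inj : injective average.
Proof.
move=> A B; have [s [t ->]] := diagP A; have [s' [t' ->]] := diagP B.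
rewrite !average_diag => /diag_inj[es et].
(* The matrix with rows (2/3, 1/3) and (1/3, 2/3) has the inverse with rows (2, -1) and (-1, 2). *)
have inv (u v : R[i]) : 2 * ((2 * u + v) / 3) - (2 * v + u) / 3 = u by field.
by congr diag; [rewrite -[s](inv s t) | rewrite -[t](inv t s)];
  rewrite es et inv.
Qed.

Lemma average_linear : linear average.
Proof.
move=> c A B; apply: val_inj; apply/funext => p.
have [s [t ->]] := diagP A; have [s' [t' ->]] := diagP B.
by congr pair; rewrite /= !(scalerA, =^~ scalerDl); congr (_ *: _); ring.
Qed.

Lemma average_unital : average (os_one diag_system) = os_one diag_system.
Proof.
have -> : os_one diag_system = diag 1 1.
  by apply: val_inj; apply/funext => -[x y]; congr pair; rewrite scale1r.
by rewrite average_diag; congr diag; field.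
Qed.

Lemma swap_adjoint (p q : H2) : hsum_inner (swap p) q = hsum_inner p (swap q).
Proof. by rewrite /hsum_inner addrC. Qed.

(** As [swap] is self-adjoint, the quadratic form of the image at [p] is 2/3 of the form of [A] at
    [p] plus 1/3 of the form of [A] at the swapped vectors. *)
Lemma average_cp : completely_positive average.
Proof.
move=> n A Apos p.
have -> : \sum_i \sum_j inner H2 (val (map_mx average A i j) (p j)) (p i) =
    3^-1 * (2 * (\sum_i \sum_j inner H2 (val (A i j) (p j)) (p i)) +
      \sum_i \sum_j inner H2 (val (A i j) (swap (p j))) (swap (p i))).
  rewrite mulr_sumr -big_split mulr_sumr; apply: eq_bigr => i _.
  rewrite mulr_sumr -big_split mulr_sumr; apply: eq_bigr => j _.
  by rewrite mxE linearZl_LR linearDl linearZl_LR /= swap_adjoint.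
by rewrite mulr_ge0 ?invr_ge0 // addr_ge0 ?mulr_ge0 //; exact: Apos.
Qed.

Definition average_ucp : ucp diag_system diag_system :=
  Ucp average_linear average_unital average_cp.

Lemma average_mono : @monomorphism (opsystem_category R) _ _ average_ucp.
Proof.
move=> W g1 g2 /(congr1 (@ucp_fun _ _ _)) /= e; apply: ucp_ext => w.
by apply: average_inj; exact: (congr1 (fun h => h w) e).
Qed.

Lemma diag_mx_positive t : 0 <= t -> mx_positive (const_mx (diag 0 t) : 'M_1).
Proof.
move=> t0 p; rewrite !big_ord1 mxE /= /hsum_inner /= scale0r linear0l add0r.
by rewrite linearZl_LR /= inner_norm mulr_ge0 ?exprn_ge0.
Qed.

End Diagonal.

(** * The map from the diagonal system to an arbitrary system *)

Section Compression.
Variables (R : realType) (Z : opsystem R).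
Local Notation H := (os_hilbert Z).
Hypothesis H_neq0 : exists x : H, x != 0.
Local Notation D := (diag_system H_neq0).

(** This is $V^* A V$ for the isometry $V x = (x, 0)$. On [diag s t] it is [s] times the identity,
    hence it lands in every operator system on [H]. *)
Definition compression_fun (A : os_elt D) : H -> H := fun x => (val A (x, 0)).1.

Lemma compression_subproof (A : os_elt D) : compression_fun A \in os_space Z.
Proof.
have [s [t ->]] := diagP A.
have -> : compression_fun (diag H_neq0 s t) = s *: id by [].
by rewrite rpredZ // os_id.
Qed.

Definition compression (A : os_elt D) : os_elt Z :=
  exist _ (compression_fun A) (compression_subproof A).

Lemma compression_linear : linear compression.
Proof. by move=> c A B; apply: val_inj. Qed.

Lemma compression_unital : compression (os_one D) = os_one Z.
Proof. exact: val_inj. Qed.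

Lemma compression_cp : completely_positive compression.
Proof.
(* On vectors supported in the first summand, the form of [A] is that of its compression. *)
move=> n A Apos x; have := Apos (fun i => (x i, 0)).
congr (0 <= _); apply: eq_bigr => i _; apply: eq_bigr => j _.
by rewrite mxE /= /hsum_inner /= linear0r addr0.
Qed.

Definition compression_ucp : ucp D Z :=
  Ucp compression_linear compression_unital compression_cp.

End Compression.

(** * Non-existence of injective objects *)

Lemma os_hilbert_neq0 (R : realType) (Z : opsystem R) :
  exists x : os_hilbert Z, x != 0.
Proof.
have [a _ a0] := os_neq0 Z; apply: contra_notP a0 => noX.
(* Some value of the nonzero operator [a] is the required nonzero vector. *)
apply/funext => x; apply/eqP/negPn/negP => ax0.
by apply: noX; exists (a x).
Qed.

Theorem theorem6p7 (R : realType) :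
  ~ exists Z : opsystem_category R, injective_object Z.
Proof.
move=> [Z Zinj]; have Hn0 := os_hilbert_neq0 Z.
have [g gi] := Zinj _ _ (compression_ucp Hn0) _ (@average_mono _ _ Hn0).
(* The averaging map sends (-1, 2) to ((-2 + 2)/3, (4 - 1)/3) = (0, 1), so the factorization
   determines [g] there. *)
have gE : g (diag Hn0 0 1) = compression (diag Hn0 (-1) 2).
  rewrite -[RHS]/(compression_ucp Hn0 (diag Hn0 (-1) 2)) -gi /= average_diag.
  by congr (g (diag _ _ _)); field.
have [x x0] := Hn0.
(* Positivity of [g] on 1 by 1 matrices already fails: at the vector [x] it would give $-\|x\|^2 \ge
   0$. *)
have := @ucp_cp _ _ _ g _ _ (@diag_mx_positive _ _ Hn0 _ ler01) (fun=> x).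
rewrite !big_ord1 !mxE gE /= /compression_fun /= scaleN1r linearNl /= inner_norm.
by rewrite oppr_ge0 => /le_gtF; rewrite exprn_gt0 ?normr_gt0.
Qed.
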